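(* For every nonnegative integer $n$, $$\sum_{j=0}^{\infty}pod(j)\,p\!\left(\frac n2-\frac j2\right)=\sum_{j=0}^{\infty}p(j)\,p\!\left(\frac n4-\frac j4\right),$$ where $p(x)=0$ if $x$ is not an integer.
   Context: $p(n)$ denotes the number of (unrestricted) partitions of $n$, with $p(0)=1$ and $p(x)=0$ for $x<0$. $pod(n)$ denotes the number of partitions of $n$ in which odd parts are distinct and even parts may be repeated, with $pod(0)=1$. *)

(* Defs.v *)
From mathcomp Require Import all_boot all_order all_algebra.
From mathcomp Require Import boolp classical_sets functions cardinality fsbigop.

Set Implicit Arguments.
Unset Strict Implicit.
Unset Printing Implicit Defensive.

Import Order.TTheory GRing.Theory Num.Theory.

Definition is_partition (n : nat) (s : seq nat) : bool :=
  [&& sorted geq s, all (fun i => 0 < i) s & sumn s == n].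

Definition distinct_odd_parts (s : seq nat) : bool :=
  uniq [seq i <- s | odd i].

(* A partition of n has at most n parts, each at most n, so the partitions of n
   can be counted in a finite type: see [partition_in_bseq]. *)
Definition npart (n : nat) : nat :=
  #|[set s : n.-bseq 'I_n.+1 | is_partition n (map val s)]|.

Definition npod (n : nat) : nat :=
  #|[set s : n.-bseq 'I_n.+1 |
      is_partition n (map val s) && distinct_odd_parts (map val s)]|.

(* [npart] extended by 0 to all rationals that are not nonnegative integers *)
Definition npartq (x : rat) : nat :=
  if x \is a Num.nat then npart (Num.truncn x) else 0.

Lemma partition_in_bseq (n : nat) (s : seq nat) :
  is_partition n s -> exists! t : n.-bseq 'I_n.+1, map val t = s.
Proof.
case/and3P=> _ s_gt0 /eqP sum_s.
have sz : size s <= n.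
  rewrite -sum_s; elim: s s_gt0 {sum_s} => //= x s IHs /andP[x0 /IHs le_s].
  by rewrite -add1n leq_add.
have bnd : all (fun i => i < n.+1) s.
  apply/allP => i s_i; rewrite ltnS -sum_s (perm_sumn (perm_to_rem s_i)) /=.
  exact: leq_addr.
have szt : size (map (@inord n) s) <= n by rewrite size_map.
exists (Bseq szt); split=> [|t ts].
  rewrite /= -map_comp -[RHS]map_id; apply/eq_in_map => i s_i /=.
  by rewrite inordK //; apply: (allP bnd).
apply/val_inj => /=; rewrite -ts -map_comp -[RHS]map_id.
by apply: eq_map => i /=; rewrite inord_val.
Qed.

(* The sums over all [j : nat] with terms [F j * npartq ((n - j) / d)] are
   finitely supported, so the default value of [\sum_(j \in _)] on infinite
   supports is not used. *)
Lemma npartq_finite_support (F : nat -> nat) (n d : nat) :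
  finite_set [set j : nat |
    F j * npartq (n%:R / d.+1%:R - j%:R / d.+1%:R)%R <> 0]%classic.
Proof.
apply: (sub_finite_set _ (finite_II n.+1)) => j /= Fj.
rewrite ltnS leqNgt; apply/negP => lt_nj; apply: Fj.
rewrite /npartq; case: ifP => [/Num.Theory.natr_ge0|_]; last by rewrite muln0.
by rewrite -mulrBl pmulr_lge0 ?invr_gt0 ?ltr0n // subr_ge0 ler_nat leqNgt lt_nj.
Qed.

(* Main.v *)
Require Import Defs.
From mathcomp Require Import all_boot all_order all_algebra.
From mathcomp Require Import boolp classical_sets functions cardinality fsbigop.
From mathcomp Require Import zify.

(** Both sides count pairs of partitions: on the left (l, m) with l having
    distinct odd parts and |l| + 2|m| = n, on the right (l', m') with
    |l'| + 4|m'| = n.  A bijection sends (l, m) to (l', m') by moving every odd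
    part of m into l, twice, and halving the remaining (even) parts of m.  The
    multiplicity in l' of an odd i then determines that of i in l (its parity)
    and in m (its half). *)

(** * Duplicate-free lists of partitions and of pairs of partitions *)

Section Enumeration.
Local Open Scope nat_scope.

(** Plain sequences replace the bounded type used for counting, so that bijections can be built on
    lists. The predicate [Q] covers both [npart] ([predT]) and [npod] ([distinct_odd_parts]). *)
Definition partitions (Q : pred (seq nat)) (n : nat) : seq (seq nat) :=
  [seq map val t |
     t : n.-bseq 'I_n.+1 <- enum [set t : n.-bseq 'I_n.+1 |
                 is_partition n (map val t) && Q (map val t)]].

Lemma mem_partitions (Q : pred (seq nat)) (n : nat) (s : seq nat) :
  (s \in partitions Q n) = is_partition n s && Q s.
Proof.
apply/mapP/idP => [[t]|/andP[s_part s_Q]]; first by rewrite mem_enum inE => ? ->.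
have [t [ts _]] := partition_in_bseq s_part.
by exists t; rewrite ?mem_enum ?inE ts // s_part.
Qed.

Lemma partitions_uniq (Q : pred (seq nat)) (n : nat) : uniq (partitions Q n).
Proof.
rewrite map_inj_uniq ?enum_uniq // => t u /(inj_map val_inj).
exact: val_inj.
Qed.

Lemma size_partitions (n : nat) : size (partitions predT n) = npart n.
Proof.
by rewrite size_map -cardE; apply: eq_card => t; rewrite !inE andbT.
Qed.

Lemma size_partitions_pod (n : nat) :
  size (partitions distinct_odd_parts n) = npod n.
Proof. by rewrite size_map -cardE. Qed.

(** The empty list when [d] does not divide [n - j] mirrors the convention that $p$ vanishes off the
    integers. *)
Definition partition_pairs (Q : pred (seq nat)) (d n : nat) :
    seq (seq nat * seq nat) :=
  [seq lm | j <- iota 0 n.+1,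
     lm <- if d %| n - j
           then [seq (l, m) | l <- partitions Q j,
                              m <- partitions predT ((n - j) %/ d)]
           else [::]].

Lemma mem_partition_pairs (Q : pred (seq nat)) (d n : nat) (l m : seq nat) :
  0 < d ->
  ((l, m) \in partition_pairs Q d n) =
  [&& is_partition (sumn l) l, Q l, is_partition (sumn m) m
    & sumn l + d * sumn m == n].
Proof.
move=> d0; apply/allpairsPdep/idP.
- move=> [j [[l' m'] [+ + [-> ->]]]]; rewrite mem_iota /= add0n ltnS => le_jn.
  case: ifP => // dv /allpairsP[[a b] /= [+ + [-> ->]]].
  rewrite !mem_partitions andbT => /andP[lP lQ] mP.
  have /and3P[_ _ /eqP lE] := lP; have /and3P[_ _ /eqP mE] := mP.
  by rewrite lE mE lP lQ mP /= mulnC divnK // subnKC.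
- case/and4P=> lP lQ mP /eqP <-.
  exists (sumn l), (l, m); split=> //.
    by rewrite mem_iota /= add0n ltnS leq_addr.
  rewrite addKn dvdn_mulr // mulKn //.
  by apply/allpairsP; exists (l, m); rewrite !mem_partitions lP lQ mP.
Qed.

Lemma partition_pairs_uniq (Q : pred (seq nat)) (d n : nat) :
  uniq (partition_pairs Q d n).
Proof.
apply: allpairs_uniq_dep; first exact: iota_uniq.
  move=> j _; case: ifP => // _.
  by apply: allpairs_uniq; rewrite ?partitions_uniq // => -[? ?] [? ?].
(* A pair arises for a single index, since that index is the sum of its first component. *)
move=> u v /allpairsPdep[j [[l m] [_ + ->]]] /allpairsPdep[k [[l' m'] [_ + ->]]].
case: ifP => // _ /allpairsP[[a b] /= [aP _ [-> _]]].
case: ifP => // _ /allpairsP[[a' b'] /= [aP' _ [-> _]]] /= [aa mm].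
move: aP aP'; rewrite !mem_partitions aa mm.
by move=> /andP[/and3P[_ _ /eqP<-] _] /andP[/and3P[_ _ /eqP<-] _].
Qed.

Lemma size_partition_pairs (Q : pred (seq nat)) (d n : nat) :
  size (partition_pairs Q d n) =
  \sum_(j < n.+1) size (partitions Q j) *
    (if d %| n - j then npart ((n - j) %/ d) else 0).
Proof.
rewrite size_allpairs_dep sumnE big_map -[iota _ _]/(index_iota 0 n.+1) big_mkord.
apply: eq_bigr => j _; case: ifP => _; last by rewrite muln0.
by rewrite size_allpairs size_partitions.
Qed.

End Enumeration.

(** * The bijection on pairs, studied through multiplicities of parts *)

Section Bijection.
Local Open Scope nat_scope.

(** A partition is determined by its multiplicities; equalities of partitions below thus become
    arithmetic on [count_mem]. *)
Lemma geq_sorted_eq (s t : seq nat) :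
  sorted geq s -> sorted geq t -> (forall i, count_mem i s = count_mem i t) ->
  s = t.
Proof.
move=> s_sorted t_sorted st.
apply: (@sorted_eq _ geq) => //.
- by move=> a b c ba ac; apply: leq_trans ac ba.
- by move=> a b; rewrite andbC => /anti_leq.
- by apply/allP => i _ /=; rewrite st.
Qed.

Lemma geq_total : total geq. Proof. by move=> a b; apply: leq_total. Qed.

Lemma count_mem_sort (i : nat) (s : seq nat) :
  count_mem i (sort geq s) = count_mem i s.
Proof. exact/permP/permEl/perm_sort. Qed.

Lemma sumn_sort (s : seq nat) : sumn (sort geq s) = sumn s.
Proof. exact/perm_sumn/permEl/perm_sort. Qed.

Lemma count_mem_filter (a : pred nat) (i : nat) (s : seq nat) :
  count_mem i (filter a s) = if a i then count_mem i s else 0.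
Proof.
elim: s => [|x s IHs] /=; first by case: (a i).
case: (boolP (a x)) => ax /=; rewrite IHs; case: (eqVneq x i) => [<-|//] /=.
  by rewrite ax.
by rewrite (negbTE ax).
Qed.

Lemma count_mem_half_even (k : nat) (s : seq nat) :
  count_mem k [seq i./2 | i <- s & ~~ odd i] = count_mem k.*2 s.
Proof.
elim: s => [|x s IHs] //=; case: (boolP (odd x)) => ox /=; rewrite IHs.
  by case: (eqVneq x k.*2) ox => [->|//]; rewrite odd_double.
by congr (_ + _); rewrite -{2}(even_halfK ox) (inj_eq double_inj).
Qed.

Lemma count_mem_double (i : nat) (s : seq nat) :
  count_mem i (map double s) = if odd i then 0 else count_mem i./2 s.
Proof.
rewrite count_map; case: (boolP (odd i)) => [oi|ei].
  by rewrite (eq_count (a2 := pred0)) ?count_pred0 // => x /=; lia.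
by apply: eq_count => x /=; rewrite -{1}(even_halfK ei) (inj_eq double_inj).
Qed.

Lemma count_mem_nseqs (f : nat -> nat) (i : nat) (s : seq nat) :
  uniq s -> count_mem i (flatten [seq nseq (f j) j | j <- s]) = (i \in s) * f i.
Proof.
elim: s => //= x s IHs /andP[xs s_uniq].
rewrite count_cat IHs // count_nseq in_cons /= eq_sym.
by case: eqVneq xs => [->|_ _]; rewrite ?mul0n // => /negbTE->; rewrite addn0.
Qed.

Lemma distinct_odd_partsP (s : seq nat) :
  reflect (forall i, odd i -> count_mem i s <= 1) (distinct_odd_parts s).
Proof.
apply: (iffP idP) => [s_uniq i oi|s_le1].
  have := count_uniq_mem i s_uniq; rewrite count_mem_filter oi => ->.
  exact: leq_b1.
apply: count_mem_uniq => i; rewrite count_mem_filter mem_filter.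
case: ifP => //= oi; have := s_le1 i oi; rewrite -has_pred1 has_count.
by case: (count_mem i s) => [|[|]].
Qed.

(** Only the first component is sorted again: filtering and halving keep a list weakly
    decreasing. *)
Definition pod_fwd (x : seq nat * seq nat) : seq nat * seq nat :=
  let odds := [seq i <- x.2 | odd i] in
  (sort geq (x.1 ++ odds ++ odds), [seq i./2 | i <- x.2 & ~~ odd i]).

(** Running over [undup y.1] meets each part once, so [nseq] prescribes its new multiplicity. Of $k$
    copies of an odd part, $k \bmod 2$ stay and $\lfloor k/2 \rfloor$ go to the second component. *)
Definition pod_bwd (y : seq nat * seq nat) : seq nat * seq nat :=
  (sort geq (flatten [seq nseq (if odd i then nat_of_bool (odd (count_mem i y.1))
                                else count_mem i y.1) i | i <- undup y.1]),
   sort geq (flatten [seq nseq (if odd i then (count_mem i y.1)./2 else 0) i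
                     | i <- undup y.1] ++ map double y.2)).

Lemma count_pod_fwd1 (i : nat) (x : seq nat * seq nat) :
  count_mem i (pod_fwd x).1 =
  count_mem i x.1 + (if odd i then (count_mem i x.2).*2 else 0).
Proof. by rewrite count_mem_sort !count_cat count_mem_filter; case: ifP; lia. Qed.

(** An odd part $i$ of [x.2] weighs $2i$ and becomes two copies of $i$; an even part $2k$ weighs
    $4k$ and becomes $k$ with weight 4. *)
Lemma sumn_pod_fwd (x : seq nat * seq nat) :
  sumn (pod_fwd x).1 + 4 * sumn (pod_fwd x).2 = sumn x.1 + 2 * sumn x.2.
Proof.
rewrite sumn_sort !sumn_cat /=; elim: x.2 => [|i s IHs] /=; first lia.
by case: (boolP (odd i)) => oi /=; [|have := even_halfK oi]; lia.
Qed.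

(** Removes the membership factor left by [count_mem_nseqs]: outside [s] the multiplicity is 0,
    where [f] vanishes. *)
Lemma mem_count_mul (i : nat) (s : seq nat) (f : nat -> nat) :
  f 0 = 0 -> (i \in undup s) * f (count_mem i s) = f (count_mem i s).
Proof.
move=> f0; rewrite mem_undup; case: (boolP (i \in s)) => [_|/count_memPn->].
  by rewrite mul1n.
by rewrite f0.
Qed.

Lemma count_pod_bwd1 (i : nat) (y : seq nat * seq nat) :
  count_mem i (pod_bwd y).1 =
  if odd i then odd (count_mem i y.1) : nat else count_mem i y.1.
Proof.
rewrite count_mem_sort count_mem_nseqs ?undup_uniq //.
case: ifP => _; first exact: (mem_count_mul _ _ (fun k => odd k)).
exact: (mem_count_mul _ _ id).
Qed.

Lemma count_pod_bwd2 (i : nat) (y : seq nat * seq nat) :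
  count_mem i (pod_bwd y).2 =
  if odd i then (count_mem i y.1)./2 else count_mem i./2 y.2.
Proof.
rewrite count_mem_sort count_cat count_mem_double count_mem_nseqs ?undup_uniq //.
case: ifP => _; last by rewrite muln0.
by rewrite addn0 (mem_count_mul _ _ half).
Qed.

(** For odd $i$ the new multiplicity is $a + 2b$ with $a \le 1$, which determines $a$ and $b$. Even
    parts keep their multiplicity, in [x.2] after halving. *)
Lemma pod_fwd_inj (x y : seq nat * seq nat) :
  sorted geq x.1 -> sorted geq x.2 -> sorted geq y.1 -> sorted geq y.2 ->
  distinct_odd_parts x.1 -> distinct_odd_parts y.1 ->
  pod_fwd x = pod_fwd y -> x = y.
Proof.
move=> x1S x2S y1S y2S /distinct_odd_partsP xQ /distinct_odd_partsP yQ xy.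
have E1 i := congr1 (fun z => count_mem i z.1) xy.
have E2 i := congr1 (fun z => count_mem i z.2) xy.
rewrite [x]surjective_pairing [y]surjective_pairing.
congr pair; apply: geq_sorted_eq => // i.
- have := E1 i; rewrite !count_pod_fwd1.
  by case: (boolP (odd i)) => [oi|_]; [have := xQ i oi; have := yQ i oi|]; lia.
(* For even [i], the copies of [i] in the second component are those of [i./2] after halving. *)
- have := E1 i; have := E2 i./2; rewrite !count_pod_fwd1 !count_mem_half_even.
  case: (boolP (odd i)) => [oi _|ei]; first by have := xQ i oi; have := yQ i oi; lia.
  by rewrite even_halfK.
Qed.

Lemma half_even_sorted (s : seq nat) :
  sorted geq s -> sorted geq [seq i./2 | i <- s & ~~ odd i].
Proof.
move=> s_sorted; apply: (homo_sorted (e := geq)); first by move=> a b; apply: half_leq.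
by apply: sorted_filter => // a b c ba ac; apply: leq_trans ac ba.
Qed.

Lemma pod_bwdK (y : seq nat * seq nat) :
  sorted geq y.1 -> sorted geq y.2 -> pod_fwd (pod_bwd y) = y.
Proof.
move=> y1S y2S; rewrite [y in RHS]surjective_pairing [LHS]surjective_pairing.
congr pair; apply: geq_sorted_eq => //.
- exact/sort_sorted/geq_total.
- move=> i; rewrite count_pod_fwd1 count_pod_bwd1 count_pod_bwd2.
  by case: (odd i); [rewrite odd_double_half|rewrite addn0].
- exact/half_even_sorted/sort_sorted/geq_total.
- by move=> i; rewrite count_mem_half_even count_pod_bwd2 odd_double doubleK.
Qed.

(** Positivity of the parts, stated as a multiplicity, comes within reach of the counting lemmas. *)
Lemma is_partition_sumn (s : seq nat) :
  is_partition (sumn s) s = sorted geq s && (count_mem 0 s == 0).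
Proof.
rewrite /is_partition eqxx andbT; congr (_ && _).
by elim: s => //= x s ->; case: x.
Qed.

Lemma perm_partition_pairs (n : nat) :
  perm_eq (map pod_fwd (partition_pairs distinct_odd_parts 2 n))
          (partition_pairs predT 4 n).
Proof.
apply: uniq_perm; last 1 first.
- move=> [l' m']; apply/mapP/idP => [[[l m]]|].
  + rewrite !mem_partition_pairs // !is_partition_sumn.
    case/and4P=> /andP[lS l0] _ /andP[mS m0] /eqP sum_n E.
    have -> : l' = (pod_fwd (l, m)).1 by rewrite -E.
    have -> : m' = (pod_fwd (l, m)).2 by rewrite -E.
    (* No part 0 appears: 0 is even and is the half of 0 only. *)
    rewrite sumn_pod_fwd sum_n eqxx count_pod_fwd1 count_mem_half_even /=.
    by rewrite (eqP l0) (eqP m0) half_even_sorted // sort_sorted //; apply: geq_total.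
  + rewrite mem_partition_pairs // !is_partition_sumn.
    case/and4P=> /andP[lS l0] _ /andP[mS m0] /eqP sum_n.
    have K : pod_fwd (pod_bwd (l', m')) = (l', m') by apply: pod_bwdK.
    (* Odd parts are kept with a boolean as multiplicity. *)
    have Q : distinct_odd_parts (pod_bwd (l', m')).1.
      apply/distinct_odd_partsP => i oi.
      by rewrite count_pod_bwd1 oi; case: (odd _).
    exists (pod_bwd (l', m')) => //.
    rewrite [pod_bwd _]surjective_pairing mem_partition_pairs //.
    rewrite -sumn_pod_fwd K sum_n eqxx andbT !is_partition_sumn.
    rewrite !sort_sorted ?count_pod_bwd1 ?count_pod_bwd2; try exact: geq_total.
    by rewrite Q l0 m0.
- rewrite map_inj_in_uniq ?partition_pairs_uniq // => -[l m] [l' m'].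
  rewrite !mem_partition_pairs // !is_partition_sumn.
  case/and4P=> /andP[lS _] lQ /andP[mS _] _.
  case/and4P=> /andP[lS' _] lQ' /andP[mS' _] _.
  exact: pod_fwd_inj.
- exact: partition_pairs_uniq.
Qed.

End Bijection.

(** * From sums over all indices with rational arguments to list sizes *)

Local Open Scope classical_set_scope.
Local Open Scope ring_scope.
Import Order.TTheory GRing.Theory Num.Theory.

(** The argument is the rational $(n-j)/d$, a natural number exactly when $d$ divides $n-j$. *)
Lemma npartq_div (n d j : nat) : (0 < d)%N -> (j <= n)%N ->
  npartq (n%:R / d%:R - j%:R / d%:R) =
  if (d %| n - j)%N then npart ((n - j) %/ d) else 0%N.
Proof.
move=> d0 jn; have dr0 : d%:R != 0 :> rat by rewrite pnatr_eq0 -lt0n.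
rewrite /npartq -mulrBl -natrB //; case: ifP => [/natrP[k kE]|nat_x].
  have -> : (n - j = k * d)%N.
    by apply/eqP; rewrite -(eqr_nat rat) natrM -kE mulfVK.
  by rewrite dvdn_mull // mulnK // natrM mulfK // natrK.
case: ifP => // /dvdnP[k kE]; case/negP: nat_x.
by rewrite kE natrM mulfK // natr_nat.
Qed.

Lemma npartq_lt0 (n d j : nat) : (0 < d)%N -> (n < j)%N ->
  npartq (n%:R / d%:R - j%:R / d%:R) = 0%N.
Proof.
move=> d0 nj; rewrite /npartq; case: ifP => // /natr_ge0.
by rewrite -mulrBl pmulr_lge0 ?invr_gt0 ?ltr0n // subr_ge0 ler_nat leqNgt nj.
Qed.

Lemma fsum_partition_pairs (Q : pred (seq nat)) (d n : nat) : (0 < d)%N ->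
  \sum_(j \in [set: nat])
     (size (partitions Q j) * npartq (n%:R / d%:R - j%:R / d%:R))%N
  = size (partition_pairs Q d n).
Proof.
(* Terms with [j > n] have a negative argument and vanish, so the sum is cut down to [j < n.+1]. *)
move=> d0; rewrite size_partition_pairs -(fsbig_widen `I_n.+1) //; last first.
  move=> j [_ /= /negP]; rewrite -leqNgt => nj.
  by rewrite npartq_lt0 // muln0.
rewrite -fsbig_ord; apply: eq_bigr => j _.
by rewrite npartq_div // -ltnS.
Qed.

Theorem theorem4p12 (n : nat) :
  \sum_(j \in [set: nat])
     (npod j * npartq (n%:R / 2%:R - j%:R / 2%:R))%N
  = \sum_(j \in [set: nat])
     (npart j * npartq (n%:R / 4%:R - j%:R / 4%:R))%N.
Proof.
under eq_fsbigr do rewrite -size_partitions_pod.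
under [RHS]eq_fsbigr do rewrite -size_partitions.
rewrite !fsum_partition_pairs // -(size_map pod_fwd).
exact/perm_size/perm_partition_pairs.
Qed.
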